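(* Let $K$ be a field of characteristic zero, let $n\geq 2$ be a natural number, and let $\mathfrak{u}_n = K\partial_1+P_1\partial_2+\cdots+P_{n-1}\partial_n$ be the Lie algebra over $K$ of unitriangular polynomial derivations of the polynomial algebra $P_n=K[x_1,\ldots,x_n]$. Then every monomorphism of the Lie algebra $\mathfrak{u}_n$ (that is, every injective $K$-linear Lie algebra homomorphism $\varphi:\mathfrak{u}_n\to\mathfrak{u}_n$) is an automorphism of the Lie algebra $\mathfrak{u}_n$.
   Context: $K$ is a field of characteristic zero. For $i\geq 1$, $P_i:=K[x_1,\ldots,x_i]$ is the polynomial algebra in $i$ variables over $K$ (with $P_0:=K$), and $P_1\subset P_2\subset\cdots\subset P_n$ in the natural way. $\partial_i:=\frac{\partial}{\partial x_i}$, $i=1,\ldots,n$, are the partial derivatives, regarded as $K$-linear derivations of $P_n$. $\mathrm{Der}_K(P_n)=\bigoplus_{i=1}^n P_n\partial_i$ is the Lie algebra of all $K$-derivations of $P_n$, with bracket $[\delta,\delta']=\delta\delta'-\delta'\delta$. For $n\geq 2$, the Lie algebra of unitriangular polynomial derivations is the Lie subalgebra $$\mathfrak{u}_n:=K\partial_1+P_1\partial_2+\cdots+P_{n-1}\partial_n=\bigoplus_{i=1}^n P_{i-1}\partial_i$$ of $\mathrm{Der}_K(P_n)$; that is, it consists of the derivations $\sum_{i=1}^n p_i\partial_i$ with $p_i\in P_{i-1}=K[x_1,\ldots,x_{i-1}]$ for all $i$ (so $p_1\in K$). Lie algebra homomorphisms are $K$-linear. *)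

(* Defs.v *)
From HB Require Import structures.
From mathcomp Require Import all_boot all_order all_algebra.
From mathcomp Require Import boolp functions.
From mathcomp Require Import mpoly.

Set Implicit Arguments.
Unset Strict Implicit.
Unset Printing Implicit Defensive.

Import GRing.Theory.
Local Open Scope ring_scope.

(* Variables are numbered from 0: the paper's x_(i+1) is 'X_i, so that the   *)
(* coefficient of the derivation d/d'X_i lies in K['X_0, ..., 'X_(i-1)].    *)

Section InitialPoly.
Variables (K : fieldType) (n : nat).
Implicit Types (p q : {mpoly K[n]}) (m : 'X_{1..n}).

(* K['X_0, ..., 'X_(k-1)], as a subalgebra of {mpoly K[n]}.                   *)
Definition initial_poly (k : nat) : {pred {mpoly K[n]}} :=
  fun p => all (fun m => [forall j : 'I_n, (k <= j)%N ==> (m j == 0%N)])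
               (msupp p).

Lemma initial_polyP k p :
  reflect (forall m (j : 'I_n), m \in msupp p -> (k <= j)%N -> m j = 0%N)
          (p \in initial_poly k).
Proof.
apply: (iffP allP) => H m.
  by move=> j /H /forallP /(_ j) /implyP h /h /eqP.
by move=> mp; apply/forallP => j; apply/implyP => kj; apply/eqP/H.
Qed.

Lemma initial_poly_submod k : submod_closed (initial_poly k).
Proof.
split; first by apply/initial_polyP => m j; rewrite msupp0.
move=> c p q /initial_polyP Hp /initial_polyP Hq; apply/initial_polyP => m j.
move=> /msuppD_le; rewrite mem_cat => /orP[/msuppZ_le|]; [exact: Hp|exact: Hq].
Qed.

HB.instance Definition _ k :=
  GRing.isSubmodClosed.Build K {mpoly K[n]} (initial_poly k)
    (initial_poly_submod k).

Lemma initial_polyM k p q :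
  p \in initial_poly k -> q \in initial_poly k -> p * q \in initial_poly k.
Proof.
move=> /initial_polyP Hp /initial_polyP Hq; apply/initial_polyP => m j.
move=> /msuppM_le /allpairsP [[m1 m2]] /= [/Hp h1 /Hq h2 ->] kj.
by rewrite mnmDE h1 // h2.
Qed.

Lemma initial_poly_le k l p :
  (k <= l)%N -> p \in initial_poly k -> p \in initial_poly l.
Proof.
move=> kl /initial_polyP Hp; apply/initial_polyP => m j mp lj.
by apply: Hp => //; apply: leq_trans lj.
Qed.

Lemma initial_poly_mderiv k (i : 'I_n) p :
  p \in initial_poly k -> p^`M(i) \in initial_poly k.
Proof.
move=> /initial_polyP Hp; apply/initial_polyP => m j.
rewrite mcoeff_msupp mcoeff_deriv => nz kj.
have /Hp/(_ kj) : (m + U_(i))%MM \in msupp p.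
  by rewrite mcoeff_msupp; apply: contraNneq nz => ->; rewrite mul0rn.
by rewrite mnmDE => /eqP; rewrite addn_eq0 => /andP[/eqP].
Qed.

Lemma initial_poly_mderiv0 k (i : 'I_n) p :
  (k <= i)%N -> p \in initial_poly k -> p^`M(i) = 0.
Proof.
move=> ki /initial_polyP Hp; apply/mpolyP => m.
rewrite mcoeff_deriv mcoeff0; apply/eqP; apply: contraT => nz.
have /Hp/(_ ki) : (m + U_(i))%MM \in msupp p.
  by rewrite mcoeff_msupp; apply: contraNneq nz => ->; rewrite mul0rn.
by rewrite mnmDE mnm1E eqxx addn1.
Qed.

End InitialPoly.

Section Unitriangular.
Variables (K : fieldType) (n : nat).
Local Notation P := {mpoly K[n]}.
Implicit Types (p q : 'I_n -> P) (D E : P -> P).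

Definition is_derivation D : Prop :=
  linear D /\ forall f g, D (f * g) = D f * g + f * D g.

Definition commutator D E : P -> P := fun f => D (E f) - E (D f).

Definition vector_field p : P -> P := fun f => \sum_(i < n) p i * f^`M(i).

Definition unitriangular : {pred P -> P} :=
  fun D => `[< exists p, (forall i : 'I_n, p i \in initial_poly i)
                         /\ D = vector_field p >].

Lemma unitriangularP D :
  reflect (exists p, (forall i : 'I_n, p i \in initial_poly i)
                     /\ D = vector_field p)
          (D \in unitriangular).
Proof. exact: asboolP. Qed.

Lemma vector_field_derivation p : is_derivation (vector_field p).
Proof.
split=> [c f g|f g]; rewrite /vector_field.
  rewrite scaler_sumr -big_split /=; apply: eq_bigr => i _.
  by rewrite mderivD mderivZ mulrDr scalerAr.
rewrite mulr_suml mulr_sumr -big_split /=; apply: eq_bigr => i _.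
by rewrite mderivM mulrDr; congr (_ + _); [exact: mulrA|exact: mulrCA].
Qed.

Lemma unitriangular_derivation D : D \in unitriangular -> is_derivation D.
Proof. by move=> /unitriangularP [p [_ ->]]; apply: vector_field_derivation. Qed.

Lemma unitriangular_submod : submod_closed unitriangular.
Proof.
split.
  apply/unitriangularP; exists (fun=> 0); split=> [i|]; first exact: rpred0.
  by apply/funext => f; rewrite /vector_field big1 // => i _; rewrite mul0r.
move=> c _ _ /unitriangularP [p [Hp ->]] /unitriangularP [q [Hq ->]].
apply/unitriangularP; exists (fun i => c *: p i + q i); split=> [i|].
  by apply: rpredD (Hq i); apply: rpredZ.
apply/funext => f; rewrite /vector_field.
transitivity (c *: (\sum_(i < n) p i * f^`M(i)) + \sum_(i < n) q i * f^`M(i)).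
  by [].
rewrite scaler_sumr -big_split /=; apply: eq_bigr => i _.
by rewrite mulrDl scalerAl.
Qed.

HB.instance Definition _ :=
  GRing.isSubmodClosed.Build K (P -> P) unitriangular
    unitriangular_submod.

Lemma unitriangular_commutator D E :
  D \in unitriangular -> E \in unitriangular ->
  commutator D E \in unitriangular.
Proof.
move=> /unitriangularP [p [Hp ->]] /unitriangularP [q [Hq ->]].
have coefP (r s : 'I_n -> P) (i : 'I_n) :
    (forall j : 'I_n, r j \in initial_poly j) ->
    (forall j : 'I_n, s j \in initial_poly j) ->
    vector_field r (s i) \in initial_poly i.
  move=> Hr Hs; apply: rpred_sum => j _; case: (leqP i j) => ij.
    by rewrite (initial_poly_mderiv0 ij (Hs i)) mulr0 rpred0.
  apply: initial_polyM; first exact: initial_poly_le (ltnW ij) (Hr j).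
  exact: initial_poly_mderiv.
apply/unitriangularP.
exists (fun i => vector_field p (q i) - vector_field q (p i)).
split=> [i|]; first by rewrite rpredB ?coefP.
have compE (r s : 'I_n -> P) f : vector_field r (vector_field s f) =
    \sum_(i < n) vector_field r (s i) * f^`M(i)
    + \sum_(i < n) \sum_(j < n) r j * s i * f^`M(i)^`M(j).
  have [lin mul] := vector_field_derivation r.
  pose h := GRing.isLinear.Build K P P *:%R (vector_field r) lin.
  pose L : {linear P -> P} := HB.pack (vector_field r) h.
  rewrite {2}/vector_field -[vector_field r]/(L : P -> P) raddf_sum.
  rewrite -big_split /=; apply: eq_bigr => i _.
  rewrite mul; congr (_ + _); rewrite mulr_sumr; apply: eq_bigr => j _.
  by rewrite mulrCA mulrA.
apply/funext => f; rewrite /commutator !compE.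
have -> : \sum_(i < n) \sum_(j < n) q j * p i * f^`M(i)^`M(j) =
          \sum_(i < n) \sum_(j < n) p j * q i * f^`M(i)^`M(j).
  rewrite exchange_big /=; apply: eq_bigr => i _; apply: eq_bigr => j _.
  by rewrite mderiv_comm [q i * _]mulrC.
rewrite opprD addrACA subrr addr0 -sumrB.
by apply: eq_bigr => i _; rewrite mulrBl.
Qed.

(* The Lie algebra u_n; its K-vector space structure is the pointwise one.    *)
Record unitri : Type := Unitri {
  unitri_val :> P -> P;
  unitri_valP : unitri_val \in unitriangular
}.

HB.instance Definition _ := [isSub for unitri_val].
HB.instance Definition _ := [Choice of unitri by <:].
HB.instance Definition _ := [SubChoice_isSubLmodule of unitri by <:].

Definition unitri_bracket (u v : unitri) : unitri :=
  Unitri (unitriangular_commutator (unitri_valP u) (unitri_valP v)).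

Definition lie_endomorphism (phi : unitri -> unitri) : Prop :=
  linear phi /\
  forall u v, phi (unitri_bracket u v) = unitri_bracket (phi u) (phi v).

Definition lie_monomorphism (phi : unitri -> unitri) : Prop :=
  lie_endomorphism phi /\ injective phi.

Definition lie_automorphism (phi : unitri -> unitri) : Prop :=
  lie_endomorphism phi /\
  exists psi, [/\ lie_endomorphism psi, cancel phi psi & cancel psi phi].

End Unitriangular.

(* Main.v *)
(* Let F_k be the ideal of the fields whose first k coefficients vanish.  Every
   element of F_(k+1) is a bracket [d/dX_k, E] of elements of F_k and [F_k, F_k]
   lies in F_(k+1), so a monomorphism phi preserves all F_k; by descending
   induction on k, it also reflects them.  On F_k / F_(k+1), which is the module
   K[X_0, ..., X_(k-1)], phi induces an injective semilinear map.  Surjectivity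
   of phi modulo F_k is proved by induction on k: the image N of this map is
   then a submodule.  A proper submodule has bounded degree in X_(k-1), so if
   N were proper, some power of d/dX_(k-1) would kill N, and by injectivity the
   same power of a preimage D of d/dX_(k-1) would kill K[X_0, ..., X_(k-1)].  In
   characteristic zero a nilpotent derivation of a domain is zero, so D would
   lie in F_k, a contradiction. *)

Require Import Defs.
From mathcomp Require Import all_boot all_order all_algebra.
From mathcomp Require Import boolp functions.
From mathcomp Require Import mpoly.
From HB Require Import structures.
Import GRing.Theory.
Local Open Scope ring_scope.

(** * Initial subalgebras and partial derivatives in characteristic zero *)

Section Polynomials.
Set Implicit Arguments.
Unset Strict Implicit.
Variables (K : fieldType) (n : nat).
Hypothesis char0 : [pchar K] =i pred0.
Local Notation P := {mpoly K[n]}.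
Implicit Types (p q f : P) (i j : 'I_n) (k r : nat).

Lemma natf_eq0_char0 (m : nat) : (m%:R == 0 :> K) = (m == 0%N).
Proof. exact: ((pcharf0P K).1 char0). Qed.

Lemma mulrn_eq0_char0 (c : K) (m : nat) :
  (c *+ m == 0) = (m == 0%N) || (c == 0).
Proof. by rewrite -mulr_natr mulf_eq0 natf_eq0_char0 orbC. Qed.

Lemma mpolyC_initial_poly (c : K) k : c%:MP_[n] \in initial_poly k.
Proof.
apply/initial_polyP => m j; rewrite msuppC.
by case: (c == 0) => //; rewrite inE => /eqP -> _; rewrite mnm0E.
Qed.

Lemma mpolyX_initial_poly i k : (i < k)%N -> 'X_i \in initial_poly (K := K) k.
Proof.
move=> ik; apply/initial_polyP => m j; rewrite msuppX inE => /eqP -> kj.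
rewrite mnm1E; case: eqP => // ij; move: (leq_trans ik kj).
by rewrite ij ltnn.
Qed.

Lemma initial_poly0 p : p \in initial_poly 0 -> p = (p@_0)%:MP.
Proof.
move=> /initial_polyP H; apply/mpolyP => m; rewrite mcoeffC.
have [->|m0] := eqVneq m 0%MM; rewrite ?mulr1 //.
rewrite mulr0; apply/eqP; apply: contraNT m0 => nz.
apply/eqP/mnmP => j; rewrite mnm0E; apply: H => //.
by rewrite mcoeff_msupp.
Qed.

Lemma initial_polyS_mderiv_eq0 i p :
  p \in initial_poly i.+1 -> p^`M(i) = 0 -> p \in initial_poly i.
Proof.
move=> /initial_polyP H dp0; apply/initial_polyP => m j mp.
rewrite leq_eqVlt => /orP[/eqP/val_inj <-|]; last exact: H.
apply/eqP; apply: contraLR mp => mi0.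
have Um : (U_(i) <= m)%MM by rewrite lep1mP.
rewrite mcoeff_msupp negbK.
have := congr1 (mcoeff (m - U_(i))) dp0.
rewrite mcoeff_mderiv submK // mcoeff0 => /eqP.
by rewrite mulrn_eq0_char0.
Qed.

Lemma mderiv_preimage i k p : (i < k)%N -> p \in initial_poly k ->
  exists2 q, q \in initial_poly k & q^`M(i) = p.
Proof.
move=> ik /initial_polyP Hp.
exists (\sum_(m <- msupp p) (p@_m / (m i).+1%:R) *: 'X_[m + U_(i)]).
  rewrite big_seq; apply: rpred_sum => m mp; apply: rpredZ.
  apply/initial_polyP => m' j; rewrite msuppX inE => /eqP -> kj.
  rewrite mnmDE Hp // mnm1E; case: eqP => // ij.
  by move: (leq_trans ik kj); rewrite ij ltnn.
rewrite raddf_sum [RHS]mpolyE; apply: eq_bigr => m _ /=.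
rewrite mderivZ mderivX mnmDE mnm1E eqxx addn1 addmK scalerA.
by rewrite divfK // natf_eq0_char0.
Qed.

Lemma iter_mderiv_eq0 i r p : (msize p <= r)%N -> iter r (mderiv i) p = 0.
Proof.
move=> pr; rewrite -mderivn_iter; apply/mpolyP => m.
rewrite mcoeff_mderivm mcoeff0 memN_msupp_eq0 ?mul0rn //.
apply/negP => /msize_mdeg_lt; rewrite mdegD mdegMn mdeg1 mul1n => h.
by move: (leq_trans (leq_ltn_trans (leq_addr _ _) h) pr); rewrite ltnn.
Qed.

(** For [m'] nonzero, [mlead p + m'] exceeds the leading monomial, so only the constant term
    survives; it is the leading coefficient times a product of factorials. *)
Lemma mderivm_mlead p :
  p != 0 -> exists2 c : K, c != 0 & p^`M[mlead p] = c%:MP.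
Proof.
move=> p0; set m := mlead p.
exists (p@_m *+ (\prod_(i < n) (m i) ^_ (m i))).
  rewrite mulrn_eq0_char0 negb_or mleadc_eq0 p0 andbT -lt0n.
  by apply/prodn_gt0 => i; rewrite ffactnn fact_gt0.
apply/mpolyP => m'; rewrite mcoeff_mderivm mcoeffC.
have [->|m'0] := eqVneq m' 0%MM; first by rewrite mulr1 addm0.
rewrite mulr0 mcoeff_gt_mlead ?mul0rn //.
by rewrite -/m -[X in (X < _)%O]addm0 ltmc_add2r
  Order.POrderTheory.lt_neqAle le0m eq_sym m'0.
Qed.

Lemma mderivm_ind (Q : P -> Prop) : (forall i p, Q p -> Q p^`M(i)) ->
  forall m p, Q p -> Q p^`M[m].
Proof.
move=> QD m p Qp; rewrite mderivm_foldr.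
by elim: (flatten _) => //= i s IH; apply: QD.
Qed.

Lemma iter_mderivM0 i r p q : p^`M(i) = 0 ->
  iter r (mderiv i) (p * q) = p * iter r (mderiv i) q.
Proof.
by move=> p0; elim: r => //= r ->; rewrite mderivM p0 mul0r add0r.
Qed.

Lemma iter_mderiv_comm i j r p :
  iter r (mderiv i) p^`M(j) = (iter r (mderiv i) p)^`M(j).
Proof. by elim: r => //= r ->; rewrite mderiv_comm. Qed.

Lemma initial_poly_iter_mderiv i r k p :
  p \in initial_poly k -> iter r (mderiv i) p \in initial_poly k.
Proof. by move=> pk; elim: r => //= r; apply: initial_poly_mderiv. Qed.

(* A submodule of K[X_0, ..., X_k] is proper only if its elements have bounded
   degree in X_k: from [w] with [(d/dX_k)^(r+1) w = 1], the vector fields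
   [h d/dX_k] produce every leading term [h X_k^r] modulo lower degree. *)
Lemma unbounded_submodule_full (k : 'I_n) (N : P -> Prop) :
  (forall f, N f -> f \in initial_poly k.+1) ->
  (forall c f g, N f -> N g -> N (c *: f + g)) ->
  (forall j h f, h \in initial_poly j -> N f -> N (h * f^`M(j))) ->
  (forall r, exists2 f, N f & iter r (mderiv k) f != 0) ->
  forall f, f \in initial_poly k.+1 -> N f.
Proof.
move=> Nk Nlin Nder Nunb.
(* Induction on a strict bound [r] for the degree in [X_k]. *)
suff H r f : f \in initial_poly k.+1 -> iter r (mderiv k) f = 0 -> N f.
  by move=> f fk; apply: (H (msize f)) => //; apply: iter_mderiv_eq0.
elim: r f => [|r IH] f fk.
  move=> /= ->; have [g Ng _] := Nunb 0%N.
  by rewrite -(addNr g) -scaleN1r; apply: Nlin.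
move=> df0; set h := iter r (mderiv k) f.
have hk : h \in initial_poly k.
  by apply: initial_polyS_mderiv_eq0 => //; apply: initial_poly_iter_mderiv.
have [v Nv v0] := Nunb r.+1.
have [c c0 cE] := mderivm_mlead v0.
pose Q p := exists2 w, N w & iter r.+1 (mderiv k) w = p.
(* [N] is stable under partial derivatives, and these commute with [d/dX_k]; differentiating [v]
   along the leading monomial of its iterated derivative yields [w]. *)
have [w Nw wE] : Q c%:MP.
  rewrite -cE; apply: (@mderivm_ind Q) => [j _ [w Nw <-]|]; last by exists v.
  exists w^`M(j); last by rewrite iter_mderiv_comm.
  by rewrite -[w^`M(j)]mul1r; apply: Nder => //;
    rewrite -mpolyC1 mpolyC_initial_poly.
have chk : c^-1 *: h \in initial_poly k by apply: rpredZ.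
have Nf1 := Nder k _ _ chk Nw; set f1 := _ * _ in Nf1.
have f1k := Nk _ Nf1.
(* The [r]-th derivatives of [f1] and [f] in [X_k] both equal [h], so [f - f1] falls under the
   induction hypothesis. *)
rewrite -(subrK f1 f) -[f - f1]scale1r; apply: Nlin => //.
apply: IH; first by rewrite rpredB.
rewrite -mderivn_iter linearB /= !mderivn_iter iter_mderivM0; last first.
  by apply: initial_poly_mderiv0 chk.
rewrite -iterSr wE -scalerAl mulrC mul_mpolyC scalerA mulVf // scale1r.
exact: subrr.
Qed.

End Polynomials.

(** If [D (D f) = 0], then [D^r (f^r) = r! (D f)^r]; the left side vanishes, so [D f = 0] in
    characteristic zero. Applied to [f = D^s g], this lowers the nilpotency order one step at a
    time. *)
Lemma nilpotent_derivation_eq0 (K : fieldType) (n : nat)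
    (D : {mpoly K[n]} -> {mpoly K[n]}) (A : {mpoly K[n]} -> Prop) (r : nat) :
  [pchar K] =i pred0 -> is_derivation D ->
  A 1 -> (forall f g, A f -> A g -> A (f * g)) -> (forall f, A f -> A (D f)) ->
  (forall f, A f -> iter r D f = 0) ->
  forall f, A f -> D f = 0.
Proof.
move=> char0 [Dlin DM] A1 AM AD Dr.
pose L : {linear {mpoly K[n]} -> {mpoly K[n]}} :=
  HB.pack D (GRing.isLinear.Build _ _ _ _ _ Dlin).
have D0 : D 0 = 0 by exact: (raddf0 L).
have DZ c x : D (c *: x) = c *: D x by exact: (linearZ_LR L).
suff sq0 f : A f -> D (D f) = 0 -> D f = 0.
  move=> f Af; elim: r Dr => [|r IH] Dr.
    by rewrite -[RHS](Dr (D f)) //=; apply: AD.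
  case: r IH Dr => [|r] IH Dr; first exact: (Dr f).
  apply: IH => g Ag; rewrite iterS; apply: sq0; last exact: (Dr g).
  by elim: r {Dr} => //= r; apply: AD.
move=> Af DDf; apply/eqP/negPn/negP => Df0.
have AX m : A (f ^+ m).
  by elim: m => [|m IH]; rewrite ?expr0 // exprS; apply: AM.
have DX m : D (f ^+ m) = m%:R *: (f ^+ m.-1 * D f).
  elim: m => [|m IH].
    rewrite expr0 scale0r; have := DM 1 1; rewrite !mulr1 !mul1r => /eqP.
    by rewrite -subr_eq subrr => /eqP.
  rewrite exprS DM IH /= -[in RHS]natr1 scalerDl scale1r addrC.
  congr (_ + _); last by rewrite mulrC.
  rewrite -scalerAr; case: m {IH} => [|m].
    by rewrite !scale0r.
  by rewrite mulrA -exprS.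
have DDX m : D (D f ^+ m) = 0.
  elim: m => [|m IH]; first by have := DX 0%N; rewrite !expr0 scale0r.
  by rewrite exprS DM DDf IH mul0r mulr0 addr0.
have iterX m j : iter j D (f ^+ (j + m)) =
    ((j + m) ^_ j)%:R *: (f ^+ m * D f ^+ j).
  elim: j m => [|j IH] m; first by rewrite ffactn0 scale1r mulr1.
  rewrite iterS addSnnS IH DZ DM DDX mulr0 addr0 DX /= -scalerAl scalerA.
  by rewrite -mulrA -exprS -natrM ffactnSr -addSnnS addSnnS addKn.
have := Dr _ (AX (r + 0)%N); rewrite iterX => /eqP.
rewrite scaler_eq0 mul1r addn0 natf_eq0_char0 // ffactnn expf_eq0 (negbTE Df0).
by rewrite andbF orbF => /eqP E; have := fact_gt0 r; rewrite E.
Qed.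

(** * Coefficients of unitriangular fields and the filtration by levels *)

Section Coefficients.
Set Implicit Arguments.
Unset Strict Implicit.
Variables (K : fieldType) (n : nat).
Local Notation P := {mpoly K[n]}.
Local Notation U := (unitri K n).
Implicit Types (u v : U) (f g : P) (i j : 'I_n) (k : nat).

Lemma mderiv_var i j : ('X_i : P)^`M(j) = (i == j)%:R.
Proof.
rewrite mderivX mnm1E; case: eqP => [->|_]; last by rewrite scale0r.
by rewrite scale1r -{1}[U_(j)%MM]add0m addmK mpolyX0.
Qed.

Lemma vector_fieldX (p : 'I_n -> P) i : vector_field p 'X_i = p i.
Proof.
rewrite /vector_field (bigD1 i) //= big1 ?addr0 => [|j ji].
  by rewrite mderiv_var eqxx mulr1.
by rewrite mderiv_var eq_sym (negbTE ji) mulr0.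
Qed.

Lemma unitriE u f : u f = \sum_(i < n) u 'X_i * f^`M(i).
Proof.
case: u => D /= DU; have /unitriangularP[p [_ ->]] := DU.
by rewrite {1}/vector_field; apply: eq_bigr => i _; rewrite vector_fieldX.
Qed.

Lemma unitriX_initial_poly u i : u 'X_i \in initial_poly i.
Proof.
case: u => D /= DU; have /unitriangularP[p [pP ->]] := DU.
by rewrite vector_fieldX.
Qed.

Lemma unitri_ext u v : (forall i, u 'X_i = v 'X_i) -> u = v.
Proof.
move=> uv; apply: val_inj; apply/funext => f /=.
by rewrite !unitriE; apply: eq_bigr => i _; rewrite uv.
Qed.

Lemma unitri_exists (p : 'I_n -> P) : (forall i, p i \in initial_poly i) ->
  exists u : U, forall i, u 'X_i = p i.
Proof.
move=> pP; have DU : vector_field p \in @unitriangular K n.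
  by apply/unitriangularP; exists p.
by exists (Unitri DU) => i; apply: vector_fieldX.
Qed.

Lemma unitri_single_exists j f : f \in initial_poly j ->
  exists u : U, forall i, u 'X_i = if i == j then f else 0.
Proof.
move=> fj; apply: unitri_exists => i.
by case: eqP => [->|_]; rewrite ?rpred0.
Qed.

Lemma unitri_linE (c : K) u v f : (c *: u + v) f = c *: u f + v f.
Proof. by []. Qed.

Lemma unitriBE u v f : (u - v) f = u f - v f.
Proof. by []. Qed.

Lemma unitri0E f : (0 : U) f = 0.
Proof. by []. Qed.

Lemma unitri0 u : u 0 = 0.
Proof. by rewrite unitriE big1 // => i _; rewrite mderiv0 mulr0. Qed.

(* [unitri_level k] is the ideal P_k d_(k+1) + ... + P_(n-1) d_n of u_n in the
   paper's numbering. *)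
Definition unitri_level k u : Prop := forall i, (i < k)%N -> u 'X_i = 0.

Lemma unitri_level_le k l u : (k <= l)%N -> unitri_level l u ->
  unitri_level k u.
Proof. by move=> kl ul i ik; apply: ul; apply: leq_trans kl. Qed.

Lemma unitri_levelS (k : 'I_n) u :
  unitri_level k u -> u 'X_k = 0 -> unitri_level k.+1 u.
Proof.
move=> uk uXk i; rewrite ltnS leq_eqVlt => /orP[/eqP/val_inj -> //|].
exact: uk.
Qed.

Lemma unitri_level_eq0 k u f :
  unitri_level k u -> f \in initial_poly k -> u f = 0.
Proof.
move=> uk fk; rewrite unitriE big1 // => i _.
case: (ltnP i k) => ik; first by rewrite uk // mul0r.
by rewrite (initial_poly_mderiv0 ik fk) mulr0.
Qed.

Lemma unitri_initial_poly k u f :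
  f \in initial_poly k -> u f \in initial_poly k.
Proof.
move=> fk; rewrite unitriE; apply: rpred_sum => i _.
case: (ltnP i k) => ik.
  apply: initial_polyM; last exact: initial_poly_mderiv.
  exact: initial_poly_le (ltnW ik) (unitriX_initial_poly u i).
by rewrite (initial_poly_mderiv0 ik fk) mulr0 rpred0.
Qed.

Lemma unitri_level_bracket k u v :
  unitri_level k v -> unitri_level k (unitri_bracket u v).
Proof.
move=> vk i ik; rewrite /= /commutator vk // unitri0.
rewrite (unitri_level_eq0 vk) ?subrr //; apply: unitri_initial_poly.
exact: mpolyX_initial_poly.
Qed.

Lemma unitri_level_bracketX (k : 'I_n) u v :
  unitri_level k v -> unitri_bracket u v 'X_k = u (v 'X_k).
Proof.
move=> vk; rewrite /= /commutator.
by rewrite (unitri_level_eq0 vk (unitriX_initial_poly u k)) subr0.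
Qed.

Lemma unitri_level_bracketS (k : 'I_n) u v : unitri_level k u ->
  unitri_level k v -> unitri_level k.+1 (unitri_bracket u v).
Proof.
move=> uk vk; apply: unitri_levelS; first exact: unitri_level_bracket.
rewrite unitri_level_bracketX //.
exact: unitri_level_eq0 uk (unitriX_initial_poly v k).
Qed.

(* [w] is [d/dX_k] and the coefficients of [v] are primitives in [X_k] of those
   of [u]. *)
Lemma unitri_levelS_bracket (k : 'I_n) u :
  [pchar K] =i pred0 -> unitri_level k.+1 u ->
  exists w v, [/\ unitri_level k w, unitri_level k.+1 v
                & unitri_bracket w v = u].
Proof.
move=> char0 uk.
have [w wE] := @unitri_single_exists k 1 (mpolyC_initial_poly n 1 k).
have wD f : w f = f^`M(k).
  rewrite unitriE (bigD1 k) //= big1 => [|i ik].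
    by rewrite wE eqxx mul1r addr0.
  by rewrite wE (negbTE ik) mul0r.
have /choice[p pP] : forall i, exists q,
    [/\ q \in initial_poly i, q^`M(k) = u 'X_i & (i <= k)%N -> q = 0].
  move=> i; case: (ltnP k i) => ki; last first.
    exists 0; split=> //; first exact: rpred0.
    by rewrite mderiv0 uk.
  have [q qi qD] := mderiv_preimage char0 ki (unitriX_initial_poly u i).
  by exists q.
have [v vE] : exists v : U, forall i, v 'X_i = p i.
  by apply: unitri_exists => i; case: (pP i).
exists w, v; split=> [i ik|i ik|].
- by rewrite wE; case: eqP ik => // ->; rewrite ltnn.
- by rewrite vE; case: (pP i) => _ _ ->.
apply: unitri_ext => i; rewrite /= /commutator wD vE wE.
have -> : v (if i == k then 1 else 0) = 0.
  case: eqP => _; last exact: unitri0.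
  rewrite unitriE big1 // => j _.
  by rewrite -mpolyC1 mderivC mulr0.
by rewrite subr0; case: (pP i).
Qed.

End Coefficients.

(** * Levels are preserved and reflected by a monomorphism *)

Section Monomorphism.
Set Implicit Arguments.
Unset Strict Implicit.
Variables (K : fieldType) (n : nat) (phi : unitri K n -> unitri K n).
Hypothesis char0 : [pchar K] =i pred0.
Hypothesis phi_linear : linear phi.
Hypothesis phi_bracket :
  forall u v, phi (unitri_bracket u v) = unitri_bracket (phi u) (phi v).
Hypothesis phi_inj : injective phi.
Local Notation P := {mpoly K[n]}.
Local Notation U := (unitri K n).
Implicit Types (u v : U) (f g : P) (i j : 'I_n) (k : nat).

Lemma monomorphism0 : phi 0 = 0.
Proof.
have := phi_linear (-1) 0 0.
by rewrite scaler0 addr0 scaleN1r addNr.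
Qed.

Lemma monomorphism_level k u :
  (k <= n)%N -> unitri_level k u -> unitri_level k (phi u).
Proof.
elim: k u => [|k IH] u kn uk; first by move=> i.
have [w [v [wk vk <-]]] := @unitri_levelS_bracket K n (Ordinal kn) u char0 uk.
rewrite phi_bracket; apply: (@unitri_level_bracketS _ _ (Ordinal kn)).
  by apply: IH => //; apply: ltnW.
by apply: IH; [apply: ltnW | apply: unitri_level_le vk].
Qed.

(* Bracketing with [X_i d/dX_k] for [i < k] detects the coefficient of [u] at
   [d/dX_i] and lowers the claim for [k] to the claim for [k + 1]. *)
Lemma monomorphism_level_reflect k u :
  (k <= n)%N -> unitri_level k (phi u) -> unitri_level k u.
Proof.
(* With [n - k] in place of [k], the descending induction becomes ascending; it starts at level [n],
   which contains only 0. *)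
move=> kn; rewrite -(subKn kn); move: (n - k)%N (leq_subr k n) => {kn}k.
elim: k u => [|k IH] u kn phiu.
  have /phi_inj -> : phi u = phi 0; last by move=> i; rewrite unitri0E.
  rewrite monomorphism0; apply: unitri_ext => i; rewrite unitri0E phiu //.
  by rewrite subn0.
have ln : (n - k.+1 < n)%N by rewrite ltn_subrL (leq_ltn_trans _ kn).
move=> i il; set l := Ordinal ln.
have lS : l.+1 = (n - k)%N by rewrite /= subnSK.
have [v vE] := @unitri_single_exists K n l 'X_i (mpolyX_initial_poly K il).
have vl : unitri_level l v.
  by move=> j jl; rewrite vE; case: eqP jl => // ->; rewrite ltnn.
have phivl : unitri_level l (phi v).
  by apply: monomorphism_level => //; apply: ltnW.
have /IH : unitri_level (n - k) (phi (unitri_bracket u v)).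
  by rewrite phi_bracket -lS; apply: unitri_level_bracketS.
rewrite -lS => /(_ (ltnW kn)) /(_ l (ltnSn l)).
by rewrite unitri_level_bracketX // vE eqxx.
Qed.

(** * Surjectivity, one graded piece at a time *)

Definition surjective_mod k : Prop :=
  forall u, exists v, forall i, (i < k)%N -> phi v 'X_i = u 'X_i.

(** The module [N] of the overview: level [k] modulo level [k + 1] is identified with its
    coefficients at [d/dX_k]. *)
Definition graded_image (k : 'I_n) f : Prop :=
  exists2 u, unitri_level k u & phi u 'X_k = f.

Lemma graded_image_lin (k : 'I_n) c f g :
  graded_image k f -> graded_image k g -> graded_image k (c *: f + g).
Proof.
move=> [u uk <-] [v vk <-]; exists (c *: u + v); last by rewrite phi_linear.
by move=> i ik; rewrite unitri_linE uk // vk // scaler0 addr0.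
Qed.

Lemma eq_unitri_level k u v f : (forall i, (i < k)%N -> u 'X_i = v 'X_i) ->
  f \in initial_poly k -> u f = v f.
Proof.
move=> uv fk; apply/eqP; rewrite -subr_eq0 -unitriBE; apply/eqP.
by apply: (unitri_level_eq0 _ fk) => i ik; rewrite unitriBE uv // subrr.
Qed.

(** Some [phi w] agrees with [v] on K[X_0, ..., X_(k-1)], and bracketing with [w] in the source
    becomes applying [v] to the coefficient in the image. *)
Lemma graded_image_stable (k : 'I_n) v f : surjective_mod k ->
  graded_image k f -> graded_image k (v f).
Proof.
move=> surj [u uk <-]; have [w wE] := surj v.
exists (unitri_bracket w u); first exact: unitri_level_bracket.
rewrite phi_bracket unitri_level_bracketX; last first.
  by apply: monomorphism_level => //; apply: ltnW.
exact: eq_unitri_level wE (unitriX_initial_poly _ _).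
Qed.

(* If [v^r] annihilated the graded image, then by injectivity the [r]-th power
   of a preimage of [v] modulo level [k] would annihilate K[X_0, ..., X_(k-1)],
   where no nonzero derivation is nilpotent. *)
Lemma graded_image_not_nilpotent (k : 'I_n) v r : surjective_mod k ->
  ~ unitri_level k v -> exists2 f, graded_image k f & iter r v f != 0.
Proof.
move=> surj vk; apply: contrapT => nex; apply: vk.
have nil f : graded_image k f -> iter r v f = 0.
  by move=> Nf; apply/eqP; apply: contrapT => /negP nz; apply: nex; exists f.
have [w wE] := surj v.
suff wk : unitri_level k w.
  by move=> i ik; rewrite -wE //; apply: monomorphism_level ik => //;
    apply: ltnW.
have iterw u m : unitri_level k u ->
    unitri_level k (iter m (unitri_bracket w) u) /\
    iter m (unitri_bracket w) u 'X_k = iter m w (u 'X_k) /\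
    phi (iter m (unitri_bracket w) u) 'X_k = iter m v (phi u 'X_k).
  move=> uk; elim: m => [//|m [IHl [IHw IHv]]]; split.
    exact: unitri_level_bracket.
  rewrite !iterS phi_bracket !unitri_level_bracketX //; last first.
    by apply: monomorphism_level => //; apply: ltnW.
  rewrite IHw; split=> //; rewrite -IHv.
  exact: eq_unitri_level wE (unitriX_initial_poly _ _).
move=> i ik.
apply: (@nilpotent_derivation_eq0 K n w
  (fun f => f \in initial_poly k) r) => //.
- exact: unitriangular_derivation (unitri_valP w).
- exact: (mpolyC_initial_poly n 1).
- by move=> f g; apply: initial_polyM.
- by move=> f; apply: unitri_initial_poly.
- move=> f fk; have [u uE] := @unitri_single_exists K n k f fk.
  have uk : unitri_level k u.
    by move=> j jk; rewrite uE; case: eqP jk => // ->; rewrite ltnn.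
  have [ul [uw uv]] := iterw u r uk.
  move: uw; rewrite uE eqxx => <-.
  (* The coefficient of the iterated bracket at [d/dX_k] is [w^r f]; it vanishes once the image of
     the bracket lies in level [k + 1]. *)
  suff /monomorphism_level_reflect :
    unitri_level k.+1 (phi (iter r (unitri_bracket w) u)).
    by move=> /(_ (ltn_ord k)); apply.
  apply: unitri_levelS; first by apply: monomorphism_level => //; apply: ltnW.
  by rewrite uv; apply: nil; exists u.
- exact: mpolyX_initial_poly.
Qed.

Lemma graded_image_full (k : 'I_n) f : surjective_mod k ->
  f \in initial_poly k -> graded_image k f.
Proof.
(* For index 0 there is no variable to differentiate by: the graded piece is the line [K], and a
   nonzero image fills it. *)
case: k => [[|k] kn] surj; set l := Ordinal kn => fl.
  have [u uE] := @unitri_single_exists K n l 1 (mpolyC_initial_poly n 1 l).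
  have ul : unitri_level l u by move=> i.
  have phiuX : phi u 'X_l != 0.
    apply/eqP => phiu0.
    have /monomorphism_level_reflect : unitri_level l.+1 (phi u).
      by apply: unitri_levelS => // i.
    move=> /(_ kn) /(_ l (ltnSn _)); rewrite uE eqxx => /eqP.
    by rewrite oner_eq0.
  have := initial_poly0 (unitriX_initial_poly (phi u) l).
  set c := _@_0 => cE; rewrite (initial_poly0 fl); set d := f@_0.
  have c0 : c != 0 by move: phiuX; rewrite cE mpolyC_eq0.
  exists ((d / c) *: u + 0); first by move=> i.
  rewrite phi_linear monomorphism0 addr0.
  transitivity ((d / c) *: phi u 'X_l); first by [].
  by rewrite cE -mul_mpolyC -mpolyCM divfK.
pose y := Ordinal (ltnW kn : (k < n)%N).
have der j h : h \in initial_poly j ->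
    exists v : U, forall g, v g = h * g^`M(j).
  move=> hj; have [v vE] := @unitri_single_exists K n j h hj.
  exists v => g; rewrite unitriE (bigD1 j) //= big1 => [|i ij].
    by rewrite vE eqxx addr0.
  by rewrite vE (negbTE ij) mul0r.
apply: (@unbounded_submodule_full K n char0 y (graded_image l)) => //.
- by move=> g [u _ <-]; apply: unitriX_initial_poly.
- exact: graded_image_lin.
- move=> j h g hj Ng; have [v vE] := der j h hj.
  by rewrite -vE; apply: graded_image_stable.
(* The field [d/dX_y] sends [X_y] to 1, so it lies outside level [l] and cannot be nilpotent on the
   graded image. *)
- move=> r; have [v vE] := der y 1 (mpolyC_initial_poly n 1 y).
  have [|g Ng gr] := @graded_image_not_nilpotent l v r surj.
    move=> /(_ y (ltnSn k)); rewrite vE mderiv_var eqxx mulr1.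
    by move=> /eqP; rewrite oner_eq0.
  exists g => //; rewrite (@eq_iter _ _ v) // => x.
  by rewrite vE mul1r.
Qed.

Lemma monomorphism_surjective_mod k : (k <= n)%N -> surjective_mod k.
Proof.
elim: k => [|k IH] kn u; first by exists 0.
have surj := IH (ltnW kn); have [v vE] := surj u; set l := Ordinal kn.
have [|w wl wE] := @graded_image_full l ((u - phi v) 'X_l) surj.
  exact: unitriX_initial_poly.
(* Adding [w], of level [l], corrects the coefficient at [d/dX_l] and leaves the earlier ones
   unchanged. *)
exists (1 *: w + v) => i; rewrite phi_linear unitri_linE scale1r ltnS leq_eqVlt.
case/orP => [/eqP ik|ik].
  have -> : i = l by apply: val_inj.
  by rewrite wE unitriBE subrK.
rewrite vE // (monomorphism_level (ltnW kn : (l <= n)%N) wl) ?add0r //.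
Qed.

Lemma monomorphism_surjective u : exists v, phi v = u.
Proof.
have [v vE] := @monomorphism_surjective_mod n (leqnn n) u.
by exists v; apply: unitri_ext => i; apply: vE.
Qed.

End Monomorphism.

Theorem theorem1p1 (K : fieldType) (n : nat) (phi : unitri K n -> unitri K n) :
  [pchar K] =i pred0 -> (2 <= n)%N ->
  lie_monomorphism phi -> lie_automorphism phi.
Proof.
move=> char0 _ [[philin phibr] phiinj]; split=> //.
have /choice[psi psiK] := monomorphism_surjective char0 philin phibr phiinj.
have phiK : cancel phi psi by move=> u; apply: phiinj; rewrite psiK.
exists psi; split=> //; split=> [c u v|u v]; apply: phiinj.
  by rewrite philin !psiK.
by rewrite phibr !psiK.
Qed.
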